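(* Let $S$ be a left cancellative monoid (not necessarily commutative) with operation $\cdot$ and identity element $1$. Suppose $A$ is a set and $\{h_s:s\in S\}$ is a family of functions $h_s:A\to A$ such that $h_{s\cdot t}=h_s\circ h_t$ for all $s,t\in S$ and $h_1=\mathrm{id}$. Then there exists a quadruple $(B,i,\{v_s:s\in S\},p)$ where $B$ is a set, $i:A\to B$ and $v_s:B\to B$ ($s\in S$) are injective functions, $v_{s\cdot t}=v_s\circ v_t$ for all $s,t\in S$, $v_1=\mathrm{id}$, and $p:B\to B$ is an idempotent ($p\circ p=p$) with $p(B)=i(A)$, such that $$p(v_s(i(a)))=i(h_s(a))\quad\text{for all } s\in S,\ a\in A,$$ and $B=\{v_s(i(a)):s\in S,\ a\in A\}$.
   Context: A monoid $S$ is left cancellative if $s\cdot t=s\cdot t'$ implies $t=t'$ for all $s,t,t'\in S$. *)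

(* Defs.v *)
From mathcomp Require Import all_boot.
From mathcomp Require Import boolp classical_sets.

Set Implicit Arguments.
Unset Strict Implicit.
Unset Printing Implicit Defensive.

Local Open Scope group_scope.

Definition left_cancellative (S : monoidType) : Prop :=
  forall s t t' : S, s * t = s * t' -> t = t'.

(* Main.v *)
Require Import Defs.
From mathcomp Require Import all_boot.
From mathcomp Require Import boolp classical_sets.

(** The dilation lives on the product [S * A], the free left [S]-set on [A].
    A pair [(s, a)] is the formal, unevaluated application of [h s] to [a]:
    [S] acts by left translation on the first factor, [a] embeds as [(1, a)],
    and the projection evaluates the pair [(s, a)] to [(1, h s a)].
    Translations are injective precisely because [S] is left cancellative,
    [h 1 = id] makes evaluation fix the embedded copy of [A], hence idempotent,
    and [(s, a)] is the translate by [s] of [(1, a)], so the orbits of the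
    copy of [A] exhaust the product. *)

Set Implicit Arguments.
Unset Strict Implicit.
Unset Printing Implicit Defensive.

Local Open Scope classical_set_scope.
Local Open Scope group_scope.

Theorem theorem4p1 (S : monoidType) (hS : left_cancellative S)
    (A : Type) (h : S -> A -> A)
    (hM : forall s t : S, h (s * t) = h s \o h t)
    (h1 : h 1 = id) :
  exists (B : Type) (i : A -> B) (v : S -> B -> B) (p : B -> B),
    (injective i /\ (forall s : S, injective (v s))) /\
    ((forall s t : S, v (s * t) = v s \o v t) /\ v 1 = id) /\
    (p \o p = p /\ range p = range i) /\
    (forall (s : S) (a : A), p (v s (i a)) = i (h s a)) /\
    [set: B] = [set v s (i a) | s in [set: S] & a in [set: A]].
Proof.
pose i (a : A) : S * A := (1, a).
pose v (s : S) (x : S * A) : S * A := (s * x.1, x.2).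
pose p (x : S * A) : S * A := i (h x.1 x.2).
have vi s a : v s (i a) = (s, a) by rewrite /v /i /= mulg1.
have pi a : p (i a) = i a by rewrite /p /= h1.
exists (S * A)%type, i, v, p; do 4?split.
- by move=> a b [].
- by move=> s [t a] [t' b] [/hS -> ->].
- by move=> s t; apply/funext => x; rewrite /v /= mulgA.
- by apply/funext => -[t a]; rewrite /v /= mul1g.
- by apply/funext => x; exact: pi.
- apply/seteqP; split=> _ [x _ <-]; first by exists (h x.1 x.2).
  by exists (i x); rewrite ?pi.
- by move=> s a; rewrite vi.
- by apply/seteqP; split=> // -[s a] _; exists s => //; exists a.
Qed.
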